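(* The cubic surface $X:=\{xyz=w^3\}\subset\mathbb P^3_{\mathbb C}$ is strictly self-dual.
   Context: A projective variety $X\subset\mathbb P^n$ is strictly self-dual if there are projective coordinates such that $X^\vee=X$, where $X^\vee$ is the dual variety and the dual projective space is identified with $\mathbb P^n$ via these coordinates. *)

(* Defs.v *)
From HB Require Import structures.
From mathcomp Require Import all_boot all_order all_algebra.
From mathcomp Require Import mpoly.
From mathcomp Require Import boolp classical_sets reals complex.

Set Implicit Arguments.
Unset Strict Implicit.
Unset Printing Implicit Defensive.

Import GRing.Theory.
Local Open Scope classical_set_scope.
Local Open Scope ring_scope.

Definition proj_space (K : fieldType) (n : nat) : Type :=
  {L : {vspace 'rV[K]_n.+1} | \dim L == 1%N}.

Section ProjectiveDuality.
Variables (K : closedFieldType) (n : nat).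
Implicit Types (p q h : proj_space K n) (u v w a : 'rV[K]_n.+1).
Implicit Types (f : {mpoly K[n.+1]}) (X Z A B : set (proj_space K n)).

(* [u] is a vector of homogeneous coordinates of [p]. Since [val p] has
   dimension 1, this forces [u != 0]. *)
Definition hcoords p u : Prop := val p = <[u]>%VS.

Definition is_form f : Prop := exists d : nat, f \is d.-homog.

Definition vanishes_at f p : Prop := forall u, hcoords p u -> f.@[u 0] = 0.

Definition zero_locus (F : set {mpoly K[n.+1]}) : set (proj_space K n) :=
  [set p | forall f, F f -> vanishes_at f p].

Definition zariski_closed Z : Prop :=
  exists F : set {mpoly K[n.+1]},
    (forall f, F f -> is_form f) /\ Z = zero_locus F.

Definition zariski_closure A : set (proj_space K n) :=
  [set p | forall Z, zariski_closed Z -> A `<=` Z -> Z p].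

Definition irreducible_set X : Prop :=
  X !=set0 /\
  forall A B, zariski_closed A -> zariski_closed B ->
    X `<=` A `|` B -> X `<=` A \/ X `<=` B.

Definition projective_variety X : Prop :=
  zariski_closed X /\ irreducible_set X.

Definition has_chain X (d : nat) : Prop :=
  exists Z : nat -> set (proj_space K n),
    (forall i, (i <= d)%N -> projective_variety (Z i) /\ Z i `<=` X) /\
    (forall i, (i < d)%N -> Z i `<` Z i.+1).

(* Krull dimension. *)
Definition has_dim X (d : nat) : Prop :=
  has_chain X d /\ forall e, has_chain X e -> (e <= d)%N.

(* The linear subspace of K^(n+1) whose projectivization is the embedded
   tangent space of [X] at [p]. *)
Definition tangent_space X p : set 'rV[K]_n.+1 :=
  [set w | forall f, is_form f -> (forall q, X q -> vanishes_at f q) ->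
     forall u, hcoords p u -> \sum_i (f^`M(i)).@[u 0] * w 0 i = 0].

Definition smooth_point X p : Prop :=
  X p /\
  exists (d : nat) (T : {vspace 'rV[K]_n.+1}),
    [/\ has_dim X d,
        forall w, w \in T <-> tangent_space X p w
      & \dim T = d.+1].

(* The dual projective space is identified with the projective space through
   the coordinates: [h] with homogeneous coordinates [a] stands for the
   hyperplane of equation \sum_i a_i x_i = 0. *)
Definition on_hyperplane h w : Prop :=
  forall a, hcoords h a -> \sum_i a 0 i * w 0 i = 0.

Definition tangent_hyperplanes X : set (proj_space K n) :=
  [set h | exists2 p, smooth_point X p &
     tangent_space X p `<=` [set w | on_hyperplane h w]].

Definition dual_variety X : set (proj_space K n) :=
  zariski_closure (tangent_hyperplanes X).

(* [X] read in the projective coordinates given by the invertible matrix [M],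
   in which the point of old coordinates [u] has coordinates [u *m M]. *)
Definition in_coordinates (M : 'M[K]_n.+1) X : set (proj_space K n) :=
  [set q | exists2 p, X p & forall u, hcoords p u -> hcoords q (u *m M)].

Definition strictly_self_dual X : Prop :=
  projective_variety X /\
  exists2 M : 'M[K]_n.+1, M \in unitmx &
    dual_variety (in_coordinates M X) = in_coordinates M X.

End ProjectiveDuality.

(* The homogeneous coordinates x, y, z, w are numbered 0, 1, 2, 3. *)
Definition cubic_surface (K : closedFieldType) : set (proj_space K 3) :=
  zero_locus
    [set 'X_(inord 0) * 'X_(inord 1) * 'X_(inord 2) - 'X_(inord 3) ^+ 3].

(* Main.v *)
Require Import Defs.
From mathcomp Require Import all_boot all_order all_algebra.
From mathcomp Require Import ring zify mpoly.
From mathcomp Require Import boolp classical_sets reals complex.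

(* The surface m^3 xyz = w^3 is parametrized by (a^3 : b^3 : c^3 : m abc), and
   its Gauss map sends the point with parameters (a, b, c), abc != 0, to
   (a^-3 : b^-3 : c^-3 : -3 (m abc)^-1). For m^2 = -3 this is the point with
   parameters (a^-1, b^-1, c^-1), so the Gauss map permutes the torus abc != 0,
   which is dense in the surface; and w -> m w turns xyz = w^3 into this
   surface. Everything about the surface (irreducibility, density of the torus,
   tangent vectors) is read off along polynomial curves.

   The definition of smoothness involves the Krull dimension. A chain
   Z_0 < ... < Z_e of subvarieties provides, for some D and all k, at least
   'C(k + e, e) forms of degree D k linearly independent on Z_e: if g vanishes
   on Z_i but not on Z_(i+1), then forms independent on Z_i stay independent on
   Z_(i+1) together with the products by g of forms independent on Z_(i+1), and
   this gives Pascal's recursion. On the surface the forms of degree N span at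
   most 3 (N + 1)^2 dimensions, since w^3 can be eliminated, hence e <= 2. *)

Set Implicit Arguments.
Unset Strict Implicit.
Unset Printing Implicit Defensive.

Import GRing.Theory Num.Theory.
Local Open Scope classical_set_scope.
Local Open Scope ring_scope.

(** * Polynomial curves in projective varieties *)

Section Projective.
Variables (K : closedFieldType) (n : nat).
Implicit Types (p q h : proj_space K n) (u v w a : 'rV[K]_n.+1).
Implicit Types (f : {mpoly K[n.+1]}) (g : 'I_n.+1 -> {poly K}).
Implicit Types (X Z : set (proj_space K n)).

Lemma hcoords_neq0 p u : hcoords p u -> u != 0.
Proof.
case: p => L dL; rewrite /hcoords /= => eL; move: dL.
by rewrite eL dim_vline eqb1.
Qed.

Lemma hcoords_ex p : exists u, hcoords p u.
Proof.
case: p => L dL; exists (vpick L); rewrite /hcoords /=; apply/eqP.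
rewrite eq_sym eqEdim -memvE memv_pick /= (eqP dL) dim_vline.
by rewrite lt0b vpick0 -dimv_eq0 (eqP dL).
Qed.

Definition pt u (u0 : u != 0) : proj_space K n :=
  exist _ <[u]>%VS (introT eqP (etrans (dim_vline u) (congr1 nat_of_bool u0))).

Lemma hcoords_pt u (u0 : u != 0) : hcoords (pt u0) u.
Proof. by []. Qed.

Lemma hcoordsZ p u c : c != 0 -> hcoords p u -> hcoords p (c *: u).
Proof.
move=> c0 hp; rewrite /hcoords hp; apply/eqP.
rewrite eqEdim -memvE; apply/andP; split.
  by apply/vlineP; exists c^-1; rewrite scalerA mulVf // scale1r.
by rewrite !dim_vline scaler_eq0 (negbTE c0).
Qed.

Lemma hcoords_scale p u v : hcoords p u -> hcoords p v ->
  exists2 c, c != 0 & v = c *: u.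
Proof.
move=> hu hv; have: v \in <[u]>%VS by rewrite -hu hv memv_line.
case/vlineP=> c ev; exists c => //; apply: contra (hcoords_neq0 hv).
by rewrite ev => /eqP ->; rewrite scale0r.
Qed.

Lemma meval_homog d f u c : f \is d.-homog ->
  f.@[(c *: u) 0] = c ^+ d * f.@[u 0].
Proof.
move=> /dhomogP fd; rewrite !mevalE mulr_sumr big_seq [RHS]big_seq.
apply: eq_bigr => m mf; rewrite mulrCA; congr (_ * _).
rewrite -(fd _ mf) /= mdegE -prodrXr -big_split /=; apply: eq_bigr => i _.
by rewrite mxE exprMn.
Qed.

Lemma vanishesP f p u : is_form f -> hcoords p u ->
  vanishes_at f p <-> f.@[u 0] = 0.
Proof.
move=> [d fd] hu; split=> [|fu v hv]; first exact.
have [c _ ->] := hcoords_scale hu hv.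
by rewrite (meval_homog _ _ fd) fu mulr0.
Qed.

Lemma zero_locus1_closed f : is_form f -> zariski_closed (zero_locus [set f]).
Proof. by move=> ff; exists [set f]; split=> // g ->. Qed.

Lemma closed_separate Z p : zariski_closed Z -> ~ Z p ->
  exists f, [/\ is_form f, forall q, Z q -> vanishes_at f q
             & ~ vanishes_at f p].
Proof.
move=> [F [Fform ->]] /existsNP[f /not_implyP[Ff nf]].
by exists f; split=> [||//]; [exact: Fform | move=> q; apply].
Qed.

(** * Pullback of forms along polynomial curves *)

Definition curve_pt (g : 'I_n.+1 -> {poly K}) (t : K) : 'rV[K]_n.+1 :=
  \row_i (g i).[t].

Definition pullback (g : 'I_n.+1 -> {poly K}) f : {poly K} :=
  mmap polyC g f.

Lemma pullbackM g : {morph pullback g : q r / q * r}.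
Proof. by move=> q r; rewrite /pullback rmorphM. Qed.

Lemma pullbackD g : {morph pullback g : q r / q + r}.
Proof. by move=> q r; rewrite /pullback rmorphD. Qed.

Lemma pullback0 g : pullback g 0 = 0.
Proof. by rewrite /pullback rmorph0. Qed.

Lemma pullback1 g : pullback g 1 = 1.
Proof. by rewrite /pullback rmorph1. Qed.

Lemma pullbackZ g c f : pullback g (c *: f) = c *: pullback g f.
Proof. by rewrite /pullback mmapZ mul_polyC. Qed.

Lemma pullbackX g i : pullback g 'X_i = g i.
Proof. by rewrite /pullback mmapX mmap1U. Qed.

Lemma horner_pullback g f t : (pullback g f).[t] = f.@[curve_pt g t 0].
Proof.
rewrite /pullback mevalE horner_sum; apply: eq_bigr => m _.
rewrite hornerM hornerC /mmap1 horner_prod; congr (_ * _).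
by apply: eq_bigr => i _; rewrite horner_exp mxE.
Qed.

(** An algebraically closed field is infinite: a nonzero [e * r] would have a non-root. *)
Lemma poly_eq0_generic (e r : {poly K}) : e != 0 ->
  (forall t, e.[t] != 0 -> r.[t] = 0) -> r = 0.
Proof.
move=> e0 er; apply: contrapT => /eqP r0.
have /closed_nonrootP[t] : e * r != 0 by rewrite mulf_neq0.
rewrite rootE hornerM mulf_eq0 negb_or => /andP[/er ->].
by rewrite eqxx.
Qed.

(** The chain rule. It is linear in [f] and stable under products, so checking it on the variables
    suffices. *)
Lemma deriv_pullback g f :
  (pullback g f)^`() = \sum_i pullback g (f^`M(i)) * (g i)^`().
Proof.
pose chain (q : {mpoly K[n.+1]}) :=
  (pullback g q)^`() = \sum_i pullback g (q^`M(i)) * (g i)^`().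
have chainM (q r : {mpoly K[n.+1]}) : chain q -> chain r -> chain (q * r).
  rewrite /chain pullbackM derivM => -> ->.
  rewrite mulr_suml mulr_sumr -big_split /=; apply: eq_bigr => i _.
  by rewrite mderivM pullbackD !pullbackM; ring.
have chain1 : chain 1.
  rewrite /chain pullback1 derivC big1 // => i _.
  by rewrite -mpolyC1 mderivC pullback0 mul0r.
have chainXU j : chain 'X_j.
  rewrite /chain pullbackX (bigD1 j) //= big1 => [|i ij].
    have Ujj : (U_(j) - U_(j) = 0 :> 'X_{1..n.+1})%MM.
      by apply/mnmP=> i; rewrite !mnmE subnn.
    by rewrite mderivX mnmE eqxx scale1r Ujj mpolyX0 pullback1 mul1r addr0.
  by rewrite mderivX mnmE eq_sym (negbTE ij) scale0r pullback0 mul0r.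
have chainX m : chain 'X_[m].
  rewrite mpolyXE_id; apply: (big_ind chain) => // i _.
  by elim: (m i) => [|k IH]; rewrite ?expr0 // exprS; apply: chainM.
rewrite -/(chain f); elim/mpolyind: f => [|c m f _ _].
  rewrite /chain pullback0 deriv0 big1 // => i _.
  by rewrite mderiv0 pullback0 mul0r.
rewrite /chain pullbackD derivD => ->.
rewrite pullbackZ derivZ (chainX m) scaler_sumr -big_split.
apply: eq_bigr => i _ /=.
by rewrite mderivD mderivZ pullbackD pullbackZ mulrDl scalerAl.
Qed.

(** A parameter where all [g i] vanish represents no point and imposes nothing, so curves may pass
    through the zero vector. *)
Definition curve_in X (g : 'I_n.+1 -> {poly K}) : Prop :=
  forall t p, hcoords p (curve_pt g t) -> X p.

Lemma pullback_curve X g f : curve_in X g -> (exists t, curve_pt g t != 0) ->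
  (forall q, X q -> vanishes_at f q) -> pullback g f = 0.
Proof.
move=> gX [s gs] fX.
have [i gi] : exists i, (curve_pt g s) 0 i != 0.
  apply: contrapT => /forallNP H; move/eqP: gs; apply.
  by apply/rowP=> i; rewrite [RHS]mxE; apply/eqP/negPn/negP/H.
have g0 : g i != 0.
  by apply: contraNneq gi => gi0; rewrite mxE gi0 horner0.
apply: (poly_eq0_generic g0) => t gt.
have ct : curve_pt g t != 0.
  apply: contraNneq gt => /rowP/(_ i); rewrite !mxE => ->; exact: eqxx.
rewrite horner_pullback; apply: (fX (pt ct)) => //.
exact: (gX t).
Qed.

(** If [p] escapes [A] and [q] escapes [B], forms separating them have a product that vanishes on
    [X]. Its pullback along a curve from [p] to [q] is zero, hence so is one factor, against its
    value at 0 or at 1. *)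
Lemma curve_irreducible X : X !=set0 ->
  (forall p q, X p -> X q -> exists g, [/\ curve_in X g,
     hcoords p (curve_pt g 0) & hcoords q (curve_pt g 1)]) ->
  irreducible_set X.
Proof.
move=> X0 join; split=> // A B cA cB XAB.
apply: contrapT => /not_orP[/existsNP[p /not_implyP[Xp nAp]]].
move=> /existsNP[q /not_implyP[Xq nBq]].
have [f [ff fA fp]] := closed_separate cA nAp.
have [g [gf gB gq]] := closed_separate cB nBq.
have [r [rX rp rq]] := join _ _ Xp Xq.
have /eqP : pullback r (f * g) = 0.
  apply: (pullback_curve rX).
    by exists 0; exact: hcoords_neq0 rp.
  move=> x Xx u xu; rewrite mevalM.
  by case: (XAB _ Xx) => [/fA|/gB] /(_ u xu) ->; rewrite ?mul0r ?mulr0.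
rewrite pullbackM mulf_eq0 => /orP[] /eqP r0.
  apply: fp; apply/(vanishesP ff rp).
  by rewrite -horner_pullback r0 horner0.
apply: gq; apply/(vanishesP gf rq).
by rewrite -horner_pullback r0 horner0.
Qed.

Lemma tangent_curve X p g s : curve_in X g -> hcoords p (curve_pt g s) ->
  tangent_space X p (curve_pt (fun i => (g i)^`()) s).
Proof.
move=> gX hp f _ fX u hu; have [c c0 eu] := hcoords_scale hp hu.
(* Tangency is tested at arbitrary coordinates [u] of [p]; the rescaled curve passes through [u]
   itself. *)
pose cg i := c *: g i.
have cgE t : curve_pt cg t = c *: curve_pt g t.
  by apply/rowP=> i; rewrite !mxE hornerZ.
have cgX : curve_in X cg.
  move=> t q; rewrite cgE => hq; apply: (gX t).
  by rewrite -[curve_pt g t](scalerK c0); apply: hcoordsZ; rewrite ?invr_neq0.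
have := deriv_pullback cg f.
rewrite (pullback_curve cgX) //; last first.
  by exists s; rewrite cgE -eu (hcoords_neq0 hu).
rewrite deriv0 => /(congr1 (fun r => r.[s])).
rewrite horner0 horner_sum => /esym df; apply: (mulfI c0).
rewrite mulr0 mulr_sumr -[RHS]df; apply: eq_bigr => i _.
by rewrite hornerM horner_pullback cgE -eu derivZ hornerZ mxE mulrCA.
Qed.

(** * Independent forms along a chain *)

Implicit Types (s t : seq {mpoly K[n.+1]}).

(** Independence modulo the polynomials vanishing on [Z]. Coefficients are indexed by [nat] so that
    concatenation amounts to a shift. *)
Definition indep_on Z s : Prop :=
  forall c : nat -> K,
    (forall p, Z p -> vanishes_at (\sum_(0 <= i < size s) c i *: s`_i) p) ->
  forall i, (i < size s)%N -> c i = 0.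

Lemma indep_on_sub X Z s : X `<=` Z -> indep_on X s -> indep_on Z s.
Proof. by move=> XZ indX c cZ; apply: indX => p /XZ; apply: cZ. Qed.

Lemma comb_cat_mul s t (g : {mpoly K[n.+1]}) (c : nat -> K) :
  let r := s ++ [seq g * f | f <- t] in
  \sum_(0 <= i < size r) c i *: r`_i =
  \sum_(0 <= i < size s) c i *: s`_i
  + g * \sum_(0 <= i < size t) c (i + size s)%N *: t`_i.
Proof.
rewrite /= size_cat size_map (@big_cat_nat _ _ _ (size s)) ?leq_addr //=.
congr (_ + _).
  rewrite big_nat [RHS]big_nat; apply: eq_bigr => i /andP[_ lt_is].
  by rewrite nth_cat lt_is.
rewrite -{1}[size s]add0n big_addn addKn mulr_sumr.
rewrite big_nat [RHS]big_nat; apply: eq_bigr => i /andP[_ lt_it].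
rewrite nth_cat ifN -?leqNgt ?leq_addl // addnK (nth_map 0) //.
by rewrite scalerAr.
Qed.

(** On [X] the multiples of [g] vanish, so the coefficients of [s] are zero. There remains
    [g * r = 0] on [Z], where irreducibility forces [r = 0]; the common degree [d] makes [r] a form,
    so that its zero locus is closed. *)
Lemma indep_on_cat X Z s t (g : {mpoly K[n.+1]}) d e :
  X `<=` Z -> irreducible_set Z ->
  g \is e.-homog -> (forall p, X p -> vanishes_at g p) ->
  (exists2 p, Z p & ~ vanishes_at g p) -> all (mem (d.-homog : {pred _})) t ->
  indep_on X s -> indep_on Z t -> indep_on Z (s ++ [seq g * f | f <- t]).
Proof.
move=> XZ [_ irrZ] ge gX [p Zp gp] td indX indZ c cZ.
have cs i : (i < size s)%N -> c i = 0.
  apply: indX => q Xq u hu; have := cZ q (XZ _ Xq) u hu.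
  by rewrite comb_cat_mul mevalD mevalM (gX q Xq u hu) mul0r addr0.
pose r := \sum_(0 <= i < size t) c (i + size s)%N *: t`_i.
have rd : r \is d.-homog.
  rewrite /r big_nat; apply: rpred_sum => i /andP[_ lt_it]; apply: rpredZ.
  by apply: (allP td); apply: mem_nth.
have ct i : (i < size t)%N -> c (i + size s)%N = 0.
  apply: (indZ (fun i => c (i + size s)%N)); rewrite -/r => q Zq.
  have [|||Zg|Zr] := irrZ (zero_locus [set g]) (zero_locus [set r]).
  - by apply: zero_locus1_closed; exists e.
  - by apply: zero_locus1_closed; exists d.
  - move=> x Zx; have [u hu] := hcoords_ex x; have := cZ x Zx u hu.
    rewrite comb_cat_mul big_nat big1 => [|j lt_j]; last first.
      by rewrite cs ?scale0r //; case/andP: lt_j.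
    rewrite add0r mevalM => /eqP; rewrite mulf_eq0 => /orP[] /eqP H.
      by left=> _ ->; apply/(vanishesP _ hu) => //; exists e.
    by right=> _ ->; apply/(vanishesP _ hu) => //; exists d.
  - by case: gp; apply: (Zg p).
  - exact: (Zr q).
move=> i; rewrite size_cat size_map => lt_i.
have [/cs //|le_si] := ltnP i (size s).
by rewrite -(subnK le_si) ct // ltn_subLR.
Qed.

Lemma chain_indep (Z : nat -> set (proj_space K n)) (e : nat) :
  (forall i, (i <= e)%N -> projective_variety (Z i)) ->
  (forall i, (i < e)%N -> Z i `<` Z i.+1) ->
  exists2 D, (0 < D)%N & forall m, exists s,
    [/\ ('C(m + e, e) <= size s)%N, all (mem ((D * m).-homog : {pred _})) s
      & indep_on (Z e) s].
Proof.
elim: e => [|e IHe] varZ ltZ.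
  (* A single form is required: a power of a coordinate that is nonzero at some point. *)
  exists 1%N => // m; have [_ [[p Zp] _]] := varZ 0%N isT.
  have [u hu] := hcoords_ex p.
  have [i ui] : exists i, u 0 i != 0.
    apply: contrapT => /forallNP H; move/eqP: (hcoords_neq0 hu); apply.
    by apply/rowP=> i; rewrite [RHS]mxE; apply/eqP/negPn/negP/H.
  exists [:: 'X_i ^+ m]; split=> [||c cZ [|//] _]; first by rewrite bin0.
    rewrite /= andbT; apply: dhomogMn.
    by rewrite dhomogX /= mdeg1.
  have := cZ p Zp u hu; rewrite big_nat1 /= mevalZ rmorphXn /=.
  by move/eqP; rewrite mulf_eq0 expf_eq0 mevalXU (negbTE ui) andbF orbF => /eqP.
have [||D D0 IH] := IHe.
- by move=> i ie; apply: varZ; apply: leqW.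
- by move=> i ie; apply: ltZ; apply: leqW.
have [ZZ /existsNP[p /not_implyP[Zp nZp]]] := ltZ e (leqnn _).
have [clZ [[x Zx] _]] := varZ e (leqnSn _).
have [_ irrZ] := varZ e.+1 (leqnn _).
have [g [[d gd] gZ gp]] := closed_separate clZ nZp.
have d0 : (0 < d)%N.
  rewrite lt0n; apply/eqP=> d0; apply: gp => u hu; move: gd; rewrite d0 => gd.
  have [v hv] := hcoords_ex x.
  have := meval_homog u 0 gd; rewrite expr0 mul1r => <-.
  by have := meval_homog v 0 gd; rewrite expr0 mul1r (gZ x Zx v hv) !scale0r.
(* The power [D] gives [g ^+ D] the degree [D * d], the new unit of degree, so that its products
   with the forms of [t] match the degree of those of [s]. *)
have gDd := dhomogMn D gd.
have [gDZ gDp] : (forall q, Z e q -> vanishes_at (g ^+ D) q) /\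
    ~ vanishes_at (g ^+ D) p.
  split=> [q Zq u hu|H].
    by rewrite rmorphXn /= (gZ q Zq u hu) expr0n eqn0Ngt D0.
  apply: gp => u hu; have /eqP := H u hu.
  by rewrite rmorphXn /= expf_eq0 => /andP[_ /eqP].
exists (D * d)%N; first by rewrite muln_gt0 D0.
elim=> [|m [t [le_t td indt]]].
  have [s [le_s sd inds]] := IH 0%N; exists s.
  split; last by apply: indep_on_sub ZZ inds.
    by move: le_s; rewrite !binn.
  by move: sd; rewrite !muln0.
(* Pascal's rule: [t] has at least ['C(m + e.+1, e.+1)] forms, and [s], taken at [d * m.+1 >= m.+1],
   at least ['C(m.+1 + e, e)]. *)
have [s [le_s sd inds]] := IH (d * m.+1)%N.
exists (s ++ [seq g ^+ D * f | f <- t]); split.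
- rewrite size_cat size_map addSn binS addnC leq_add //.
  by apply: leq_trans le_s; rewrite -addSnnS leq_bin2l // leq_add2r leq_pmull.
- rewrite all_cat -mulnA sd all_map; apply/allP => f ft /=.
  rewrite mulnSr mulnDr addnC [X in (X + _)%N]mulnC.
  by apply: dhomogM => //; rewrite mulnA; apply: (allP td).
by apply: (indep_on_cat ZZ irrZ gDd gDZ _ td inds indt); exists p.
Qed.

(** With more forms than spanning elements, the coefficient matrix has a nonzero left kernel vector,
    which is a dependence relation on [Z]. *)
Lemma indep_on_size Z s (I : finType) (b : I -> {mpoly K[n.+1]}) :
  (forall f, f \in s -> exists c : I -> K,
     forall p, Z p -> vanishes_at (f - \sum_j c j *: b j) p) ->
  indep_on Z s -> (size s <= #|I|)%N.
Proof.
move=> span inds; rewrite leqNgt; apply/negP => lt_Is.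
have /choice[A AP] : forall i : 'I_(size s), exists c : I -> K,
    forall p, Z p -> vanishes_at (s`_i - \sum_j c j *: b j) p.
  by move=> i; apply: span; apply: mem_nth.
pose M := \matrix_(i < size s, j < #|I|) A i (enum_val j).
have : kermx M != 0.
  rewrite -mxrank_eq0 mxrank_ker -lt0n subn_gt0.
  exact: leq_ltn_trans (rank_leq_col M) lt_Is.
case/rowV0Pn=> v /sub_kermxP vM v0.
pose c i := if insub i is Some j then v 0 j else 0.
have cE (i : 'I_(size s)) : c i = v 0 i by rewrite /c valK.
move/eqP: v0; apply; apply/rowP=> i; rewrite -cE mxE.
apply: inds (ltn_ord i) => p Zp u hu.
rewrite big_mkord raddf_sum /=.
under eq_bigr => j _.
  have /eqP := AP j p Zp u hu.
  rewrite mevalB subr_eq0 cE mevalZ => /eqP ->; rewrite raddf_sum mulr_sumr.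
  over.
rewrite exchange_big /= big1 // => k _.
have /rowP/(_ (enum_rank k)) := vM; rewrite !mxE => vMk.
rewrite -[RHS](mul0r (b k).@[u 0]) -[in RHS]vMk mulr_suml.
apply: eq_bigr => j _.
by rewrite mxE enum_rankK mevalZ mulrA.
Qed.

End Projective.

(** * The surface m^3 xyz = w^3 *)

Section CoordinateSubspace.
Variables (K : closedFieldType) (n : nat).

Definition coord_subspace (S : {set 'I_n.+1}) : set (proj_space K n) :=
  zero_locus [set f | exists2 i, i \in S & f = 'X_i].

Lemma coord_subspaceP S p u : hcoords p u ->
  coord_subspace S p <-> forall i, i \in S -> u 0 i = 0.
Proof.
move=> hu; split=> [Sp i iS|uS _ [i iS ->]].
  by have := Sp 'X_i; rewrite -mevalXU; apply => //; exists i.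
apply/(vanishesP _ hu); first by exists 1%N; rewrite dhomogX /= mdeg1.
by rewrite mevalXU uS.
Qed.

Lemma coord_subspace_variety (S : {set _}) i0 : i0 \notin S ->
  projective_variety (coord_subspace S).
Proof.
move=> i0S; split.
  exists [set f | exists2 i, i \in S & f = 'X_i]; split=> // _ [i iS ->].
  by exists 1%N; rewrite dhomogX /= mdeg1.
apply: curve_irreducible => [|p q Sp Sq].
  have e0 : delta_mx 0 i0 != 0 :> 'rV[K]_n.+1.
    apply/negP => /eqP/rowP/(_ i0); rewrite !mxE !eqxx => /eqP.
    by rewrite oner_eq0.
  exists (pt e0); apply/(coord_subspaceP _ (hcoords_pt e0)) => i iS.
  rewrite mxE.
  by rewrite (_ : i == i0 = false) // ; apply: contraNF i0S => /eqP <-.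
have [u hu] := hcoords_ex p; have [v hv] := hcoords_ex q.
exists (fun i => (u 0 i)%:P + (v 0 i - u 0 i) *: 'X); split.
- move=> t x hx; apply/(coord_subspaceP _ hx) => i iS.
  rewrite mxE !hornerE (iffLR (coord_subspaceP _ hu) Sp i iS).
  by rewrite (iffLR (coord_subspaceP _ hv) Sq i iS) subrr mul0r addr0.
- rewrite (_ : curve_pt _ 0 = u) //; apply/rowP=> i.
  by rewrite mxE !hornerE ?mulr0 ?addr0.
- rewrite (_ : curve_pt _ 1 = v) //; apply/rowP=> i.
  by rewrite mxE !hornerE /= addrC addKr.
Qed.

End CoordinateSubspace.

(** The left side is at most [3 * D ^ 2 * (k + 1) ^ 2] and the right side exceeds
    [k * (k + 1) ^ 2 / 6]; the chosen [k] makes these two bounds equal. *)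
Lemma bin3_gt D k : (0 < D)%N -> k = (18 * D ^ 2)%N ->
  ((D * k).+1 * (D * k).+1 * 3 < 'C(k + 3, 3))%N.
Proof.
move=> D0 kE.
have -> : ('C(k + 3, 3) = ((k + 3) * ((k + 2) * (k + 1))) %/ 6)%N.
  by rewrite bin_ffactd !ffactnS ffactn0 addn3 addn2 addn1 /= muln1.
rewrite leq_divRL //.
set x := (D * k).+1; set y := (k + 1)%N.
have xy : (x <= D * y)%N by nia.
have : (x * x * 18 <= k * (y * y))%N.
  have := leq_mul xy xy; nia.
nia.
Qed.

(** * The surface and its parametrization by cubes *)

Section Surface.
Variables (K : closedFieldType) (m : K).
Hypothesis m0 : m != 0.

Definition vec4 (A : nmodType) (a b c d : A) : 'rV[A]_4 :=
  \row_i [:: a; b; c; d]`_i.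
Definition quad (a b c d : {poly K}) (i : 'I_4) : {poly K} :=
  [:: a; b; c; d]`_i.

Lemma vec4P (A : nmodType) (u v : 'rV[A]_4) :
  [/\ u 0 (inord 0) = v 0 (inord 0), u 0 (inord 1) = v 0 (inord 1),
      u 0 (inord 2) = v 0 (inord 2) & u 0 (inord 3) = v 0 (inord 3)] -> u = v.
Proof.
move=> [u0 u1 u2 u3]; apply/rowP; case=> [[|[|[|[|//]]]] lt_i].
- by rewrite (_ : Ordinal _ = inord 0) //; apply: val_inj; rewrite /= inordK.
- by rewrite (_ : Ordinal _ = inord 1) //; apply: val_inj; rewrite /= inordK.
- by rewrite (_ : Ordinal _ = inord 2) //; apply: val_inj; rewrite /= inordK.
- by rewrite (_ : Ordinal _ = inord 3) //; apply: val_inj; rewrite /= inordK.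
Qed.

Lemma vec4E (A : nmodType) (a b c d : A) :
  ((vec4 a b c d 0 (inord 0) = a) * (vec4 a b c d 0 (inord 1) = b) *
   (vec4 a b c d 0 (inord 2) = c) * (vec4 a b c d 0 (inord 3) = d))%type.
Proof. by rewrite !mxE !inordK. Qed.

Lemma big_ord4 (R : Type) (idx : R) (op : Monoid.law idx) (F : 'I_4 -> R) :
  \big[op/idx]_i F i =
  op (op (op (F (inord 0)) (F (inord 1))) (F (inord 2))) (F (inord 3)).
Proof.
rewrite !big_ord_recr big_ord0 /= Monoid.mul1m.
by congr (op (op (op _ _) _) _); congr F; apply: val_inj; rewrite /= inordK.
Qed.

Lemma curve_pt_quad a b c d t :
  curve_pt (quad a b c d) t = vec4 a.[t] b.[t] c.[t] d.[t].
Proof.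
by apply/rowP=> i; rewrite !mxE /quad; case: i => [[|[|[|[|//]]]] lt_i].
Qed.

Lemma curve_pt_deriv_quad a b c d t :
  curve_pt (fun i => (quad a b c d i)^`()) t =
  vec4 a^`().[t] b^`().[t] c^`().[t] d^`().[t].
Proof.
by apply/rowP=> i; rewrite !mxE /quad; case: i => [[|[|[|[|//]]]] lt_i].
Qed.

(** A free [m] serves both the given cubic, where [m = 1], and its self-dual model, where
    [m ^+ 2 = - 3]. *)
Definition surf_form : {mpoly K[4]} :=
  m ^+ 3 *: ('X_(inord 0) * 'X_(inord 1) * 'X_(inord 2)) - 'X_(inord 3) ^+ 3.

Definition surf : set (proj_space K 3) := zero_locus [set surf_form].

Lemma surf_form_homog : surf_form \is 3.-homog.
Proof.
have X1 i : ('X_i : {mpoly K[4]}) \is 1.-homog by rewrite dhomogX /= mdeg1.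
apply: rpredB; last exact: dhomogMn (X1 _).
by apply: rpredZ; apply: (dhomogM (dhomogM (X1 _) (X1 _)) (X1 _)).
Qed.

Lemma meval_surf_form v : surf_form.@[v] =
  m ^+ 3 * (v (inord 0) * v (inord 1) * v (inord 2)) - v (inord 3) ^+ 3.
Proof. by rewrite mevalB mevalZ rmorphXn !mevalM /= !mevalXU. Qed.

Lemma pullback_surf_form g : pullback g surf_form =
  m ^+ 3 *: (g (inord 0) * g (inord 1) * g (inord 2)) - g (inord 3) ^+ 3.
Proof.
rewrite /surf_form !exprS !expr0 !mulr1 -scaleN1r.
by rewrite pullbackD !pullbackZ !pullbackM !pullbackX scaleN1r.
Qed.

Lemma surfP p u : hcoords p u -> surf p <->
  m ^+ 3 * (u 0 (inord 0) * u 0 (inord 1) * u 0 (inord 2)) = u 0 (inord 3) ^+ 3.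
Proof.
move=> hu; have ff : is_form surf_form by exists 3%N; exact: surf_form_homog.
split=> [/(_ _ erefl)/(vanishesP ff hu)|e _ ->].
  by rewrite meval_surf_form => /eqP; rewrite subr_eq0 => /eqP.
by apply/(vanishesP ff hu); rewrite meval_surf_form e subrr.
Qed.

Lemma surf_closed : zariski_closed surf.
Proof. by apply: zero_locus1_closed; exists 3%N; exact: surf_form_homog. Qed.

Lemma curve_in_surf a b c d : m ^+ 3 *: (a * b * c) = d ^+ 3 ->
  curve_in surf (quad a b c d).
Proof.
move=> e t p hp; apply/(surfP hp).
rewrite curve_pt_quad !vec4E; have /= := congr1 (horner^~ t) e.
by rewrite hornerZ horner_exp !hornerM.
Qed.

Definition cubes (a b c : K) : 'rV[K]_4 :=
  vec4 (a ^+ 3) (b ^+ 3) (c ^+ 3) (m * (a * b * c)).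

Definition cubes_curve (a b c : {poly K}) : 'I_4 -> {poly K} :=
  quad (a ^+ 3) (b ^+ 3) (c ^+ 3) (m *: (a * b * c)).

Lemma curve_pt_cubes_curve a b c t :
  curve_pt (cubes_curve a b c) t = cubes a.[t] b.[t] c.[t].
Proof. by rewrite curve_pt_quad hornerZ !horner_exp !hornerM. Qed.

Lemma cubes_curve_in_surf a b c : curve_in surf (cubes_curve a b c).
Proof. by apply: curve_in_surf; rewrite exprZn !exprMn. Qed.

Lemma cube_root (x : K) : exists y, x = y ^+ 3.
Proof.
have /closed_rootP[y] : size ('X^3 - x%:P) != 1 by rewrite size_XnsubC.
by rewrite rootE !hornerE subr_eq0 => /eqP <-; exists y.
Qed.

(** After cube roots of the first three coordinates are taken, the last one is [m * (a * b * c)] up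
    to a cube root of unity [z], which is absorbed into [a]. *)
Lemma surf_cubes p : surf p -> exists a b c, hcoords p (cubes a b c).
Proof.
have [u hu] := hcoords_ex p => /(surfP hu).
have [a ea] := cube_root (u 0 (inord 0)).
have [b eb] := cube_root (u 0 (inord 1)).
have [c ec] := cube_root (u 0 (inord 2)).
rewrite ea eb ec -!exprMn => e.
have [abc0|abc0] := eqVneq (a * b * c) 0.
  exists a, b, c; rewrite (_ : cubes a b c = u) //.
  apply: vec4P; rewrite !vec4E.
  split=> //; move: e; rewrite abc0 mulr0 expr0n /= => /esym/eqP.
  by rewrite expf_eq0 => /eqP.
pose z := u 0 (inord 3) / (m * (a * b * c)).
have mabc0 : m * (a * b * c) != 0 by rewrite mulf_neq0.
have z3 : z ^+ 3 = 1.
  by rewrite /z exprMn exprVn e divff // -e expf_neq0.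
exists (z * a), b, c; rewrite (_ : cubes _ b c = u) //.
apply: vec4P; rewrite !vec4E.
split=> //; first by rewrite exprMn z3 mul1r.
by rewrite -[RHS](divfK mabc0) -/z; ring.
Qed.

Lemma surf_variety : projective_variety surf.
Proof.
split; first exact: surf_closed.
apply: curve_irreducible => [|p q].
  have e0 : vec4 1 0 0 0 != 0 :> 'rV[K]_4.
    apply/negP => /eqP/rowP/(_ (inord 0)); rewrite vec4E mxE => /eqP.
    by rewrite oner_eq0.
  exists (pt e0); apply/(surfP (hcoords_pt e0)); rewrite !vec4E.
  by rewrite !mulr0 expr0n.
move=> /surf_cubes[a [b [c hp]]] /surf_cubes[a' [b' [c' hq]]].
exists (cubes_curve (a%:P + (a' - a) *: 'X) (b%:P + (b' - b) *: 'X)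
                    (c%:P + (c' - c) *: 'X)).
split; first exact: cubes_curve_in_surf.
  by rewrite curve_pt_cubes_curve !hornerE ?mulr0 ?addr0.
by rewrite curve_pt_cubes_curve !hornerE /= ![_ + _ - _]addrC !addKr.
Qed.

(** * The dimension of the surface *)

Lemma surf_has_chain : has_chain surf 2.
Proof.
(* The point (0 : 1 : 0 : 0), the line x = w = 0, the surface; (0 : 0 : 1 : 0) and (1 : 0 : 0 : 0)
   witness the strict inclusions. *)
pose Z i := if i is 0 then @coord_subspace K 3 [set inord 0; inord 2; inord 3]
            else if i is 1 then @coord_subspace K 3 [set inord 0; inord 3]
            else surf.
have ne (i j : nat) : (i < 4)%N -> (j < 4)%N -> i != j ->
    (inord i == inord j :> 'I_4) = false.
  by move=> i4 j4; rewrite -(inj_eq val_inj) /= !inordK // => /negbTE.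
have line_surf : Z 1%N `<=` surf.
  move=> x Zx; have [u hu] := hcoords_ex x.
  have Zu := iffLR (coord_subspaceP _ hu) Zx.
  apply/(surfP hu); rewrite (Zu (inord 0)) ?(Zu (inord 3)) ?inE ?eqxx ?orbT //.
  by rewrite !mul0r mulr0 expr0n.
have pt_line : Z 0%N `<=` Z 1%N.
  move=> x Zx; have [u hu] := hcoords_ex x.
  have Zu := iffLR (coord_subspaceP _ hu) Zx.
  apply/(coord_subspaceP _ hu) => i; rewrite !inE => /orP[] iS; apply: Zu.
    by rewrite !inE iS.
  by rewrite !inE iS orbT.
have e0 (k : nat) : (k < 4)%N -> delta_mx 0 (inord k) != 0 :> 'rV[K]_4.
  move=> _; apply/negP => /eqP/rowP/(_ (inord k)).
  by rewrite !mxE !eqxx => /eqP; rewrite oner_eq0.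
exists Z; split; case=> [|[|[|i]]] // _.
- split; last by move=> p /pt_line /line_surf.
  by apply: (@coord_subspace_variety _ _ _ (inord 1)); rewrite !inE !ne.
- split; last exact: line_surf.
  by apply: (@coord_subspace_variety _ _ _ (inord 1)); rewrite !inE !ne.
- by split; [exact: surf_variety | ].
- split=> // sub; have e2 := e0 2%N isT.
  have /sub : Z 1%N (pt e2).
    apply/(coord_subspaceP _ (hcoords_pt e2)) => i; rewrite !inE mxE eqxx /=.
    by case/orP=> /eqP ->; rewrite ne.
  move=> /(coord_subspaceP _ (hcoords_pt e2))/(_ (inord 2)).
  by rewrite !inE eqxx orbT => /(_ isT)/eqP; rewrite mxE !eqxx oner_eq0.
- split=> // sub; have e2 := e0 0%N isT.
  have /sub : Z 2%N (pt e2).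
    apply/(surfP (hcoords_pt e2)); rewrite !mxE (ne 1%N) ?(ne 3%N) //.
    by rewrite !(andbF, mulr0n, mulr0, mul0r) expr0n.
  move=> /(coord_subspaceP _ (hcoords_pt e2))/(_ (inord 0)).
  by rewrite !inE eqxx => /(_ isT)/eqP; rewrite mxE !eqxx oner_eq0.
Qed.

(** Subtraction is truncated: indices with too large a sum give monomials of another degree, which
    only enlarge a family that serves for an upper bound. *)
Definition surf_span (N : nat) (x : 'I_N.+1 * 'I_N.+1 * 'I_3) : {mpoly K[4]} :=
  'X_(inord 0) ^+ x.1.1 * 'X_(inord 1) ^+ x.1.2
  * 'X_(inord 2) ^+ (N - (x.1.1 + x.1.2 + x.2)) * 'X_(inord 3) ^+ x.2.

(* The equation of the surface replaces w^3 by a multiple of xyz, so that only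
   the exponents 0, 1, 2 of w remain. *)
Lemma surf_span_homog N (f : {mpoly K[4]}) : f \is N.-homog ->
  exists c : 'I_N.+1 * 'I_N.+1 * 'I_3 -> K, forall p, surf p ->
    vanishes_at (f - \sum_j c j *: surf_span j) p.
Proof.
pose spanned (g : {mpoly K[4]}) := exists c : 'I_N.+1 * 'I_N.+1 * 'I_3 -> K,
  forall p, surf p -> vanishes_at (g - \sum_j c j *: surf_span j) p.
have span0 : spanned 0.
  exists (fun=> 0) => p _ u _; rewrite big1 => [|j _]; rewrite ?scale0r //.
  by rewrite subrr meval0.
have spanD g h : spanned g -> spanned h -> spanned (g + h).
  move=> [c cg] [d dh]; exists (fun j => c j + d j) => p Sp u hu.
  under eq_bigr do rewrite scalerDl.
  rewrite big_split opprD addrACA mevalD.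
  by rewrite (cg p Sp u hu) (dh p Sp u hu) addr0.
have spanZ e g : spanned g -> spanned (e *: g).
  move=> [c cg]; exists (fun j => e * c j) => p Sp u hu.
  under eq_bigr do rewrite -scalerA.
  by rewrite -scaler_sumr -scalerBr mevalZ (cg p Sp u hu) mulr0.
move=> /dhomogP fN; rewrite -/(spanned f) [f]mpolyE big_seq.
apply: (big_ind spanned) => // k /fN /=; rewrite mdegE big_ord4 /= => kN.
apply: spanZ.
set k0 := k (inord 0) in kN *; set k1 := k (inord 1) in kN *.
set k2 := k (inord 2) in kN *; set k3 := k (inord 3) in kN *.
(* Replacing [q] factors w^3 by m^3 xyz raises the other three exponents by [q] and produces the
   coefficient [(m ^+ 3) ^+ q]. *)
pose q := (k3 %/ 3)%N; pose r := (k3 %% 3)%N.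
have k3E : k3 = (q * 3 + r)%N by exact: divn_eq.
have lt0 : (k0 + q < N.+1)%N by lia.
have lt1 : (k1 + q < N.+1)%N by lia.
have lt3 : (r < 3)%N by rewrite ltn_mod.
pose x := (Ordinal lt0, Ordinal lt1, Ordinal lt3).
exists (fun j => (m ^+ 3) ^+ q *+ (j == x)) => p Sp u hu.
rewrite (bigD1 x) //= big1 => [|j jx]; last first.
  by rewrite (negbTE jx) mulr0n scale0r.
rewrite eqxx mulr1n addr0 mevalB mevalZ mevalX big_ord4 /= -/k0 -/k1 -/k2 -/k3.
rewrite /surf_span /= 3!mevalM !rmorphXn /= !mevalXU.
rewrite (_ : N - _ = k2 + q)%N; last by lia.
rewrite [in X in X - _]k3E exprD mulnC exprM -(iffLR (surfP hu) Sp).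
by rewrite !exprMn !exprD; ring.
Qed.

Lemma surf_has_dim : has_dim surf 2.
Proof.
split; first exact: surf_has_chain.
move=> e [Z [Zvar Zlt]]; rewrite leqNgt; apply/negP => e3.
(* The first four members form a chain of length 3, and what spans on the surface also spans on its
   subset [Z 3]. *)
have [||D D0 HD] := @chain_indep _ _ Z 3.
- by move=> i i3; apply: (Zvar i (leq_trans i3 e3)).1.
- by move=> i i3; apply: Zlt (leq_trans i3 e3).
pose k := (18 * D ^ 2)%N; have [s [le_s sd inds]] := HD k.
have : (size s <= #|{: 'I_(D * k).+1 * 'I_(D * k).+1 * 'I_3}|)%N.
  apply: indep_on_size (@surf_span (D * k)) _ inds => f fs.
  have [c cf] := surf_span_homog (allP sd _ fs).
  by exists c => p /(Zvar 3 e3).2; apply: cf.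
rewrite !card_prod !card_ord => /(leq_trans le_s).
by apply/negP; rewrite -ltnNge; apply: bin3_gt.
Qed.

End Surface.

Lemma cubic_surfaceE (K : closedFieldType) : @cubic_surface K = surf (1 : K).
Proof.
by rewrite /cubic_surface /surf /surf_form expr1n scale1r.
Qed.

(** * The dual surface *)

Section SurfaceDual.
Variables (K : closedFieldType) (m : K).
Hypothesis m0 : m != 0.
Local Notation surf := (surf m).
Local Notation cubes := (cubes m).
Local Notation cubes_curve := (cubes_curve m).

(** The gradient is computed by differentiating the equation at 0 along the line [u + t w], which
    need not lie on the surface. *)
Lemma tangent_surf p u w : surf p -> hcoords p u -> tangent_space surf p w ->
  m ^+ 3 * (u 0 (inord 1) * u 0 (inord 2) * w 0 (inord 0)
            + u 0 (inord 0) * u 0 (inord 2) * w 0 (inord 1)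
            + u 0 (inord 0) * u 0 (inord 1) * w 0 (inord 2))
  - 3 * u 0 (inord 3) ^+ 2 * w 0 (inord 3) = 0.
Proof.
move=> Sp hu Tw.
pose g i := (u 0 i)%:P + w 0 i *: 'X.
have gE : curve_pt g 0 = u by apply/rowP=> i; rewrite mxE !hornerE.
have dg i : (g i)^`() = (w 0 i)%:P.
  by rewrite /g derivD derivC derivZ derivX add0r alg_polyC.
have g0 i : (g i).[0] = u 0 i by rewrite -gE mxE.
clearbody g.
have := Tw (surf_form m) (ex_intro _ 3%N (surf_form_homog m)) _ u hu.
move=> /(_ (fun q Sq => Sq _ erefl)) <-.
transitivity (pullback g (surf_form m))^`().[0].
  rewrite pullback_surf_form [g _ ^+ 3]exprS expr2 derivB derivZ !derivM !dg.
  rewrite !(hornerD, hornerN, hornerZ, hornerM, hornerC) !g0; ring.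
rewrite deriv_pullback horner_sum; apply: eq_bigr => i _.
by rewrite hornerM horner_pullback gE dg hornerC.
Qed.

Lemma tangent_cubes p a b c x y z : hcoords p (cubes a b c) ->
  tangent_space surf p (vec4 (3 * a ^+ 2 * x) (3 * b ^+ 2 * y) (3 * c ^+ 2 * z)
    (m * (x * b * c + a * y * c + a * b * z))).
Proof.
move=> hp; pose l e f : {poly K} := e%:P + f *: 'X.
have l0 e f : (l e f).[0] = e by rewrite /l !hornerE.
have dl e f : (l e f)^`() = f%:P.
  by rewrite /l derivD derivC derivZ derivX add0r alg_polyC.
clearbody l.
have := @tangent_curve _ _ surf p (cubes_curve (l a x) (l b y) (l c z)) 0.
rewrite curve_pt_cubes_curve !l0 => /(_ (@cubes_curve_in_surf _ _ _ _ _) hp).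
rewrite curve_pt_deriv_quad !exprS expr0 !mulr1 derivZ !derivM !dl.
rewrite !(hornerZ, hornerD, hornerM, hornerC) !l0.
by congr (tangent_space _ _ (vec4 _ _ _ _)); ring.
Qed.

Lemma tangent_quad p (A B C D : {poly K}) : m ^+ 3 *: (A * B * C) = D ^+ 3 ->
  hcoords p (vec4 A.[0] B.[0] C.[0] D.[0]) ->
  tangent_space surf p (vec4 A^`().[0] B^`().[0] C^`().[0] D^`().[0]).
Proof.
move=> eABCD; rewrite -curve_pt_quad -curve_pt_deriv_quad => hp.
by apply: tangent_curve hp; exact: curve_in_surf.
Qed.

(* The surface is singular where two of x, y, z vanish; cuspidal curves reach
   the tangent directions there that are not velocities of [cubes_curve]. *)
Lemma tangent_cusp p (A B C : {poly K}) x s :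
  A * B * C = 'X * (s ^+ 3 *: 'X^2) * (x ^+ 3)%:P ->
  hcoords p (vec4 A.[0] B.[0] C.[0] 0) ->
  tangent_space surf p (vec4 A^`().[0] B^`().[0] C^`().[0] (m * (s * x))).
Proof.
move=> eABC hp; have := @tangent_quad p A B C ((m * (s * x)) *: 'X).
rewrite derivZ derivX !hornerZ hornerX hornerC mulr0 mulr1; apply=> //.
by rewrite eABC -!mul_polyC !(rmorphXn, rmorphM) /=; ring.
Qed.

(** The tangent space is the kernel of the gradient [G]: one inclusion is [tangent_surf], and
    conversely each kernel vector is a velocity of [cubes_curve]. *)
Lemma surf_smooth p a b c : 3 != 0 :> K -> a * b * c != 0 ->
  hcoords p (cubes a b c) -> smooth_point surf p.
Proof.
move=> three0 abc0 hp; have Sp : surf p.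
  by apply/(surfP _ hp); rewrite !vec4E; ring.
split=> //.
pose G : 'cV[K]_4 := (vec4 (m ^+ 3 * (b * c) ^+ 3) (m ^+ 3 * (a * c) ^+ 3)
  (m ^+ 3 * (a * b) ^+ 3) (- (3 * m ^+ 2 * (a * b * c) ^+ 2)))^T.
have GE i : G i 0 = vec4 (m ^+ 3 * (b * c) ^+ 3) (m ^+ 3 * (a * c) ^+ 3)
  (m ^+ 3 * (a * b) ^+ 3) (- (3 * m ^+ 2 * (a * b * c) ^+ 2)) 0 i.
  by rewrite mxE.
have phiE (w : 'rV[K]_4) : (w *m G) 0 0 =
    m ^+ 3 * ((b * c) ^+ 3 * w 0 (inord 0) + (a * c) ^+ 3 * w 0 (inord 1)
              + (a * b) ^+ 3 * w 0 (inord 2))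
    - 3 * m ^+ 2 * (a * b * c) ^+ 2 * w 0 (inord 3).
  by rewrite mxE big_ord4 /= !GE !vec4E; ring.
move: abc0; rewrite !mulf_eq0 !negb_or => /andP[/andP[a0 b0] c0].
exists 2%N, (lker (linfun (mulmxr G : 'rV[K]_4 -> 'rV[K]_1))); split.
- exact: surf_has_dim.
- move=> w; rewrite memv_ker lfunE /=; split=> [/eqP wG|].
    have := phiE w; rewrite wG mxE => /esym w3.
    (* These speeds yield the first three coordinates of [w]; the relation [w3] then imposes the
       fourth. *)
    have := tangent_cubes (w 0 (inord 0) / (3 * a ^+ 2))
      (w 0 (inord 1) / (3 * b ^+ 2))
      (w 0 (inord 2) / (3 * c ^+ 2)) hp.
    rewrite (_ : vec4 _ _ _ _ = w) //; apply: vec4P; rewrite !vec4E.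
    split; try by field; rewrite ?three0 ?a0 ?b0 ?c0.
    have k0 : 3 * m ^+ 2 * (a * b * c) ^+ 2 != 0.
      by rewrite !mulf_neq0 ?expf_neq0 ?mulf_neq0.
    have {}w3 : 3 * m ^+ 2 * (a * b * c) ^+ 2 * w 0 (inord 3) =
      m ^+ 3 * ((b * c) ^+ 3 * w 0 (inord 0) + (a * c) ^+ 3 * w 0 (inord 1)
              + (a * b) ^+ 3 * w 0 (inord 2)).
      by apply/esym/eqP; rewrite -subr_eq0; apply/eqP.
    apply: (mulfI k0); rewrite w3.
    by field; rewrite ?three0 ?a0 ?b0 ?c0.
  move=> /(tangent_surf Sp hp); rewrite !vec4E => Tw.
  apply/eqP/rowP=> i; rewrite ord1 phiE mxE -Tw; ring.
have := limg_ker_dim (linfun (mulmxr G : 'rV[K]_4 -> 'rV[K]_1)) fullv.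
set phi := linfun _; rewrite capfv dimvf.
(* The vector (0, 0, 0, 1) has nonzero image, so the rank is 1 and the kernel has dimension 4 -
   1. *)
have : (0 < \dim (phi @: fullv))%N.
  rewrite lt0n dimv_eq0; apply/negP => /eqP img0.
  have := memv_img phi (memvf (vec4 0 0 0 1)).
  rewrite img0 memv0 lfunE /= => /eqP/rowP/(_ 0).
  rewrite phiE !vec4E !mulr0 !addr0 mulr0 mulr1 mxE => /eqP.
  rewrite sub0r oppr_eq0; apply/negP.
  by rewrite !mulf_neq0 ?expf_neq0 ?mulf_neq0.
have := dimvS (subvf (phi @: fullv)); rewrite dimvf.
move=> le1 gt0; have -> : \dim (phi @: fullv) = 1%N.
  by apply/eqP; rewrite eqn_leq le1 gt0.
by rewrite addn1 => -[].
Qed.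

(** * Tangent hyperplanes lie on the surface *)

Lemma horner0E :
  (forall c : K, (c%:P.[0] = c) * (c%:P^`().[0] = 0)) *
  (('X : {poly K}).[0] = 0) * (('X : {poly K})^`().[0] = 1) *
  (forall s : K, ((s *: 'X^2).[0] = 0) * ((s *: 'X^2)^`().[0] = 0)).
Proof.
do !split=> *; rewrite ?(derivC, derivX, derivZ, derivXn) //.
- by rewrite hornerC.
- by rewrite hornerC.
- by rewrite hornerX.
- by rewrite hornerC.
- by rewrite hornerZ hornerXn expr0n mulr0.
- by rewrite hornerZ hornerMn hornerXn mul0rn mulr0.
Qed.

(** Pairing [h] with velocities of curves gives linear equations on its coordinates. On the torus
    their product yields the equation of the surface; elsewhere they force [H3 = 0] and a zero among
    [H0], [H1], [H2]. *)
Lemma tangent_hyperplanes_surf : m ^+ 2 = - 3 -> 3 != 0 :> K ->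
  tangent_hyperplanes surf `<=` surf.
Proof.
move=> m2 three0 h [p [Sp _] hT]; have [H hH] := hcoords_ex h.
have HT x y z w : tangent_space surf p (vec4 x y z w) ->
    H 0 (inord 0) * x + H 0 (inord 1) * y + H 0 (inord 2) * z
    + H 0 (inord 3) * w = 0.
  by move=> /hT/(_ H hH); rewrite big_ord4 /= !vec4E.
apply/(surfP _ hH).
have [a [b [c hp]]] := surf_cubes m0 Sp.
set H0 := H 0 (inord 0) in HT *; set H1 := H 0 (inord 1) in HT *.
set H2 := H 0 (inord 2) in HT *; set H3 := H 0 (inord 3) in HT *.
have E0 : 3 * a ^+ 2 * H0 + m * b * c * H3 = 0.
  by rewrite -[RHS](HT _ _ _ _ (tangent_cubes 1 0 0 hp)); ring.
have E1 : 3 * b ^+ 2 * H1 + m * a * c * H3 = 0.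
  by rewrite -[RHS](HT _ _ _ _ (tangent_cubes 0 1 0 hp)); ring.
have E2 : 3 * c ^+ 2 * H2 + m * a * b * H3 = 0.
  by rewrite -[RHS](HT _ _ _ _ (tangent_cubes 0 0 1 hp)); ring.
have eN (x y : K) : x + y = 0 -> x = - y by move/eqP; rewrite addr_eq0 => /eqP.
(* Multiplying the three relations and [m ^+ 3] makes [- m ^+ 6] appear, which has to be 27. *)
have m6 : m ^+ 6 = - 27 by rewrite (exprM m 2 3) m2; ring.
suff: 27 * (m ^+ 3 * (H0 * H1 * H2)) = 27 * H3 ^+ 3.
  by apply: mulfI; rewrite (_ : 27 = 3 ^+ 3) ?expf_neq0 //; ring.
have [abc0|abc0] := eqVneq (a * b * c) 0; last first.
  have abc2 : (a * b * c) ^+ 2 != 0 by rewrite expf_neq0.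
  apply: (mulfI abc2).
  have -> : (a * b * c) ^+ 2 * (27 * (m ^+ 3 * (H0 * H1 * H2))) =
    m ^+ 3 * ((3 * a ^+ 2 * H0) * (3 * b ^+ 2 * H1) * (3 * c ^+ 2 * H2)).
    by ring.
  rewrite (eN _ _ E0) (eN _ _ E1) (eN _ _ E2).
  transitivity (- m ^+ 6 * (a * b * c) ^+ 2 * H3 ^+ 3); first by ring.
  by rewrite m6; ring.
suff [-> ->] : H0 * H1 * H2 = 0 /\ H3 = 0 by rewrite expr0n !mulr0.
have H_0 (k x y : K) : k != 0 -> 3 * k ^+ 2 * x + y = 0 -> y = 0 -> x = 0.
  move=> k0 + y0; rewrite y0 addr0 => /eqP.
  by rewrite !mulf_eq0 (negbTE k0) (negbTE three0) => /eqP.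
have H3_0 (k : K) : k != 0 -> m * k * H3 = 0 -> H3 = 0.
  by move=> k0 /eqP; rewrite !mulf_eq0 (negbTE m0) (negbTE k0) => /eqP.
(* The relation is affine in [s]: its difference between [s = 1] and [s = 0] isolates
   [m * y * H3]. *)
have cuspE (x y : K) : (forall s, x + m * (s * y) * H3 = 0) -> y != 0 -> H3 = 0.
  move=> e y0; apply: (H3_0 y) => //.
  by rewrite -[RHS](e 1) -[LHS]add0r -[in LHS](e 0); ring.
(* With exactly one zero parameter, [E0], [E1] and [E2] suffice. With two, the point is a coordinate
   vertex and [H3 = 0] comes from cuspidal curves. *)
have [a0|a0] := eqVneq a 0; have [b0|b0] := eqVneq b 0;
  have [c0|c0] := eqVneq c 0.
- have := hcoords_neq0 hp; rewrite a0 b0 c0 => /eqP[]; apply: vec4P.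
  by rewrite !vec4E !mxE; split; rewrite ?expr0n //; ring.
- rewrite (H_0 c H2 _ c0 E2); last by rewrite a0; ring.
  split; first by rewrite mulr0.
  apply: (cuspE H0 c) => // s; have hq : hcoords p (vec4 0 0 (c ^+ 3) 0).
    move: hp; congr hcoords; apply: vec4P.
    by rewrite !vec4E a0 b0; split=> //; ring.
  have := @tangent_cusp p 'X (s ^+ 3 *: 'X^2) (c ^+ 3)%:P c s (erefl _).
  rewrite !horner0E => /(_ hq)/HT <-; ring.
- rewrite (H_0 b H1 _ b0 E1); last by rewrite a0; ring.
  split; first by rewrite mulr0 mul0r.
  apply: (cuspE H0 b) => // s; have hq : hcoords p (vec4 0 (b ^+ 3) 0 0).
    move: hp; congr hcoords; apply: vec4P.
    by rewrite !vec4E a0 c0; split=> //; ring.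
  have := @tangent_cusp p 'X (b ^+ 3)%:P (s ^+ 3 *: 'X^2) b s (mulrAC _ _ _).
  rewrite !horner0E => /(_ hq)/HT <-; ring.
- have H3e : H3 = 0.
    by apply: (H3_0 (b * c)); rewrite ?mulf_neq0 // -[RHS]E0 a0; ring.
  by split=> //; rewrite (H_0 b H1 _ b0 E1) ?H3e; ring.
- rewrite (H_0 a H0 _ a0 E0); last by rewrite b0; ring.
  split; first by rewrite !mul0r.
  apply: (cuspE H1 a) => // s; have hq : hcoords p (vec4 (a ^+ 3) 0 0 0).
    move: hp; congr hcoords; apply: vec4P.
    by rewrite !vec4E b0 c0; split=> //; ring.
  have := @tangent_cusp p (a ^+ 3)%:P 'X (s ^+ 3 *: 'X^2) a s.
  rewrite [_%:P * 'X * _]mulrAC [_%:P * _]mulrC mulrAC.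
  rewrite [_ *: _ * 'X]mulrC => /(_ erefl).
  rewrite !horner0E => /(_ hq)/HT <-; ring.
- have H3e : H3 = 0.
    by apply: (H3_0 (a * c)); rewrite ?mulf_neq0 // -[RHS]E1 b0; ring.
  by split=> //; rewrite (H_0 a H0 _ a0 E0) ?H3e; ring.
- have H3e : H3 = 0.
    by apply: (H3_0 (a * b)); rewrite ?mulf_neq0 // -[RHS]E2 c0; ring.
  by split=> //; rewrite (H_0 a H0 _ a0 E0) ?H3e; ring.
- by move/eqP: abc0; rewrite !mulf_eq0 (negbTE a0) (negbTE b0) (negbTE c0).
Qed.

(** * The torus inside the dual variety, and its density *)

Lemma cubes_neq0 a b c : a != 0 -> cubes a b c != 0.
Proof.
move=> a0; apply/negP => /eqP/rowP/(_ (inord 0)).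
by rewrite vec4E mxE => /eqP; rewrite expf_eq0 (negbTE a0).
Qed.

(** Tangency occurs at the point with inverse parameters: there the gradient is
    [m ^+ 3 / (a * b * c) ^+ 3] times [cubes a b c], once 3 is written as [- m ^+ 2]. *)
Lemma torus_tangent_hyperplanes h a b c : m ^+ 2 = - 3 -> 3 != 0 :> K ->
  a * b * c != 0 -> hcoords h (cubes a b c) -> tangent_hyperplanes surf h.
Proof.
move=> m2 three0 abc0 hh.
have := abc0; rewrite !mulf_eq0 !negb_or => /andP[/andP[a0 b0] c0].
have hp := hcoords_pt (cubes_neq0 b^-1 c^-1 (invr_neq0 a0)).
have abcV0 : a^-1 * b^-1 * c^-1 != 0 by rewrite !mulf_neq0 ?invr_neq0.
have smp := surf_smooth three0 abcV0 hp.
exists (pt (cubes_neq0 b^-1 c^-1 (invr_neq0 a0))) => // w Tw H hH.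
have := tangent_surf smp.1 hp Tw; rewrite !vec4E => gw.
have [k k0 ->] := hcoords_scale hh hH.
rewrite big_ord4 /= !mxE -/(cubes a b c 0 _) !inordK //=.
have q0 : m ^+ 3 / (a * b * c) ^+ 3 != 0.
  by rewrite mulf_neq0 ?invr_neq0 ?expf_neq0.
apply: (mulfI q0); rewrite mulr0 -[RHS](mulr0 k) -{}gw.
have -> : 3 = - m ^+ 2 by rewrite m2 opprK.
by field; rewrite a0 b0 c0.
Qed.

(** Along the segment from the parameters [(a, b, c)] to (1, 1, 1) the product of the parameters is
    a nonzero polynomial, so the curve is generically in the torus. A form vanishing there pulls
    back to zero and vanishes at the starting point. *)
Lemma torus_dense Z : zariski_closed Z ->
  (forall h a b c, a * b * c != 0 -> hcoords h (cubes a b c) -> Z h) ->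
  surf `<=` Z.
Proof.
move=> [F [Fform ->]] torus h Sh; have [a [b [c hh]]] := surf_cubes m0 Sh.
move=> f Ff; apply/(vanishesP (Fform f Ff) hh).
pose l (e : K) : {poly K} := e%:P + (1 - e) *: 'X.
have l0 e : (l e).[0] = e by rewrite /l !hornerE.
have l1 e : (l e).[1] = 1 by rewrite /l hornerD hornerC hornerZ hornerX; ring.
have <- : curve_pt (cubes_curve (l a) (l b) (l c)) 0 = cubes a b c.
  by rewrite curve_pt_cubes_curve !l0.
rewrite -horner_pullback.
suff -> : pullback (cubes_curve (l a) (l b) (l c)) f = 0 by rewrite horner0.
apply: (@poly_eq0_generic _ (l a * l b * l c)).
  apply/negP => /eqP/(congr1 (horner^~ 1)) /=.
  by rewrite !hornerM !l1 horner0 !mulr1 => /eqP; rewrite oner_eq0.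
move=> t; rewrite !hornerM => lt0; rewrite horner_pullback curve_pt_cubes_curve.
have lat0 : (l a).[t] != 0.
  by apply: contraNneq lt0 => ->; rewrite !mul0r.
have hx := hcoords_pt (cubes_neq0 (l b).[t] (l c).[t] lat0).
exact: (torus _ _ _ _ lt0 hx f Ff).
Qed.

Lemma dual_surf : m ^+ 2 = - 3 -> 3 != 0 :> K -> dual_variety surf = surf.
Proof.
move=> m2 three0; apply/seteqP; split=> h.
  by apply; [exact: surf_closed | exact: tangent_hyperplanes_surf].
move=> Sh Z Zcl TZ; apply: torus_dense Sh => // {}h a b c abc0 hh.
by apply: TZ; apply: torus_tangent_hyperplanes hh.
Qed.

(** * Change of coordinates and conclusion *)

Lemma surf_in_coordinates :
  in_coordinates (diag_mx (vec4 1 1 1 m)) (@cubic_surface K) = surf.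
Proof.
set M := diag_mx _.
have ME (u : 'rV[K]_4) : u *m M = vec4 (u 0 (inord 0)) (u 0 (inord 1))
    (u 0 (inord 2)) (m * u 0 (inord 3)).
  apply: vec4P; rewrite !vec4E mul_mx_diag !mxE !inordK //=.
  by rewrite !mulr1 mulrC.
rewrite cubic_surfaceE; apply/seteqP; split=> q.
  move=> [p Sp pq]; have [u hu] := hcoords_ex p.
  apply/(surfP _ (pq u hu)); rewrite ME !vec4E exprMn.
  by congr (_ * _); have := iffLR (surfP _ hu) Sp; rewrite expr1n mul1r.
have [v hv] := hcoords_ex q => Sq.
pose u := vec4 (v 0 (inord 0)) (v 0 (inord 1)) (v 0 (inord 2))
  (m^-1 * v 0 (inord 3)).
have uM : u *m M = v.
  by rewrite ME; apply: vec4P; rewrite !vec4E mulVKf.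
have u0 : u != 0.
  by apply: contraNneq (hcoords_neq0 hv) => u0; rewrite -uM u0 mul0mx.
exists (pt u0).
  apply/(surfP _ (hcoords_pt u0)); rewrite !vec4E expr1n mul1r exprMn.
  by rewrite -(iffLR (surfP _ hv) Sq) exprVn mulKf // expf_neq0.
move=> u' hu'; have [k k0 ->] := hcoords_scale (hcoords_pt u0) hu'.
by rewrite -scalemxAl uM; apply: hcoordsZ.
Qed.

End SurfaceDual.

Lemma cubic_surface_strictly_self_dual (K : closedFieldType) :
  3 != 0 :> K -> strictly_self_dual (@cubic_surface K).
Proof.
move=> three0; split.
  by rewrite cubic_surfaceE; apply: surf_variety; exact: oner_neq0.
(* A square root [m] of -3, nonzero because 3 is, turns the Gauss map into inversion of the
   parameters. *)
have /closed_rootP[m] : size ('X^2 - (- 3)%:P : {poly K}) != 1.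
  by rewrite size_XnsubC.
rewrite rootE !hornerE subr_eq0 => /eqP m2.
have m0 : m != 0.
  by apply: contraNneq three0 => m0; rewrite -oppr_eq0 -m2 m0 expr0n.
exists (diag_mx (vec4 1 1 1 m)).
  rewrite unitmxE det_diag big_ord4 /= !vec4E !mul1r unitfE //.
by rewrite surf_in_coordinates // dual_surf.
Qed.

Theorem proposition32 (R : realType) : strictly_self_dual (@cubic_surface R[i]%C).
Proof. by apply: cubic_surface_strictly_self_dual; rewrite pnatr_eq0. Qed.
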